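(* For every $n\in\mathbb{Z}_{\geq 0}$ the following two identities hold, in $\mathbb{Q}[[x,y]]$: \[ \sum_{l=0}^{\infty}\sum_{m=0}^{\infty}\mathscr{B}_{m}^{(-l)}(n)\frac{x^{l}}{l!}\frac{y^{m}}{m!} = \frac{n!\,e^{x+y}}{(e^{x}+e^{y}-e^{x+y})^{n+1}} \] and \[ \sum_{l=0}^{\infty}\sum_{m=0}^{\infty}\mathscr{B}_{m}^{(-l)}(n)\,x^{l}y^{m} = \sum_{j=0}^{\infty} j!\,(j+n)!\,Q_{j}(x)Q_{j}(y), \] where $Q_{j}(X) = \dfrac{X^{j}}{(1-X)(1-2X)\cdots(1-(j+1)X)}$ for $j\in\mathbb{Z}_{\geq 0}$, expanded as a power series in $X$.
   Context: For $k\in\mathbb{Z}$ let $\mathrm{Li}_k(z)=\sum_{m\ge1} z^m/m^k$ (for $k\le 0$ this is a rational function of $z$). The poly-Bernoulli polynomials $B_n^{(k)}(x)$ ($k\in\mathbb{Z}$, $n\ge0$) are defined by $e^{-xt}\frac{\mathrm{Li}_k(1-e^{-t})}{1-e^{-t}}=\sum_{n\ge0}B_n^{(k)}(x)\frac{t^n}{n!}$. The Stirling numbers of the first kind ${n \brack j}$ are defined by ${0\brack 0}=1$, ${n\brack 0}={0\brack m}=0$ for $m,n\neq0$, and ${n+1\brack m}={n\brack m-1}+n{n\brack m}$ for $n\ge0,m\ge1$. For $l,m,n\in\mathbb{Z}_{\ge0}$ set $\mathscr{B}_{m}^{(-l)}(n)=\sum_{j=0}^{n}{n\brack j}B_m^{(-l-j)}(n)$.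 *)

(* Defs.v *)
From HB Require Import structures.
From mathcomp Require Import all_boot all_order all_algebra.
From mathcomp Require Import boolp.

Set Implicit Arguments.
Unset Strict Implicit.
Unset Printing Implicit Defensive.

Import GRing.Theory.

Local Open Scope ring_scope.

(* Formal power series.  {fps R} is R[[X]]; f n is the coefficient of X^n.    *)

Record fps (R : Type) := Fps { fps_coef : nat -> R }.
Add Printing Constructor fps.
Coercion fps_coef : fps >-> Funclass.

Notation "{ 'fps' R }" := (fps R) (format "{ 'fps'  R }") : type_scope.

Lemma fpsP (R : Type) (f g : {fps R}) : (forall n, f n = g n) <-> f = g.
Proof.
split=> [|-> //]; case: f g => [f] [g] /= fg.
by congr Fps; apply: funext.
Qed.

HB.instance Definition _ (R : Type) := gen_eqMixin {fps R}.
HB.instance Definition _ (R : Type) := gen_choiceMixin {fps R}.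

Section Ring.
Variable R : comNzRingType.
Implicit Types f g h : {fps R}.

Definition fps_zero : {fps R} := Fps (fun=> 0).
Definition fps_opp f : {fps R} := Fps (fun n => - f n).
Definition fps_add f g : {fps R} := Fps (fun n => f n + g n).
Definition fps_one : {fps R} := Fps (fun n => (n == 0%N)%:R).
Definition fps_mul f g : {fps R} :=
  Fps (fun n => \sum_(i < n.+1) f i * g (n - i)%N).

Fact fps_addA : associative fps_add.
Proof. by move=> f g h; apply/fpsP => n /=; rewrite addrA. Qed.
Fact fps_addC : commutative fps_add.
Proof. by move=> f g; apply/fpsP => n /=; rewrite addrC. Qed.
Fact fps_add0 : left_id fps_zero fps_add.
Proof. by move=> f; apply/fpsP => n /=; rewrite add0r. Qed.
Fact fps_addN : left_inverse fps_zero fps_opp fps_add.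
Proof. by move=> f; apply/fpsP => n /=; rewrite addNr. Qed.

HB.instance Definition _ := GRing.isZmodule.Build {fps R}
  fps_addA fps_addC fps_add0 fps_addN.

Let trunc N f : {poly R} := \poly_(i < N.+1) f i.

Let coef_truncM N (p q : {poly R}) f g n : (n <= N)%N ->
  (forall i, (i <= N)%N -> p`_i = f i) -> (forall i, (i <= N)%N -> q`_i = g i) ->
  (p * q)`_n = fps_mul f g n.
Proof.
move=> le_nN pf qg; rewrite coefM /=; apply: eq_bigr => i _.
rewrite pf ?qg //; first exact: leq_trans (leq_subr _ _) le_nN.
by apply: leq_trans le_nN; rewrite -ltnS.
Qed.

Let coef_trunc N f i : (i <= N)%N -> (trunc N f)`_i = f i.
Proof. by move=> le_iN; rewrite coef_poly ltnS le_iN. Qed.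

Fact fps_mulA : associative fps_mul.
Proof.
move=> f g h; apply/fpsP => n.
have T (k : {fps R}) i := @coef_trunc n k i.
have M (k k' : {fps R}) i (le_in : (i <= n)%N) :=
  @coef_truncM n _ _ k k' i le_in (T k) (T k').
by rewrite -(coef_truncM (leqnn n) (T f) (M g h)) mulrA
           (coef_truncM (leqnn n) (M f g) (T h)).
Qed.
Fact fps_mulC : commutative fps_mul.
Proof.
move=> f g; apply/fpsP => n.
have T (k : {fps R}) i := @coef_trunc n k i.
by rewrite -(coef_truncM (leqnn n) (T f) (T g)) mulrC
           (coef_truncM (leqnn n) (T g) (T f)).
Qed.
Fact fps_mul1 : left_id fps_one fps_mul.
Proof.
move=> f; apply/fpsP => n /=.
rewrite big_ord_recl /= mul1r subn0 big1 ?addr0 // => i _.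
by rewrite mul0r.
Qed.
Fact fps_mulDl : left_distributive fps_mul fps_add.
Proof.
move=> f g h; apply/fpsP => n /=; rewrite -big_split /=.
by apply: eq_bigr => i _; rewrite mulrDl.
Qed.
Fact fps_one_neq0 : fps_one != 0.
Proof.
apply/eqP => /(congr1 (fun f : {fps R} => f 0%N)) /= /eqP.
by rewrite oner_eq0.
Qed.

HB.instance Definition _ := GRing.Zmodule_isComNzRing.Build {fps R}
  fps_mulA fps_mulC fps_mul1 fps_mulDl fps_one_neq0.

Lemma fps_coef0 n : (0 : {fps R}) n = 0. Proof. by []. Qed.
Lemma fps_coefN f n : (- f) n = - f n. Proof. by []. Qed.
Lemma fps_coefD f g n : (f + g) n = f n + g n. Proof. by []. Qed.
Lemma fps_coefB f g n : (f - g) n = f n - g n. Proof. by []. Qed.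
Lemma fps_coef1 n : (1 : {fps R}) n = (n == 0%N)%:R. Proof. by []. Qed.
Lemma fps_coefM f g n : (f * g) n = \sum_(i < n.+1) f i * g (n - i)%N.
Proof. by []. Qed.
Lemma fps_coef_sum (I : Type) (r : seq I) (P : pred I) (F : I -> {fps R}) n :
  (\sum_(i <- r | P i) F i) n = \sum_(i <- r | P i) F i n.
Proof. by elim/big_rec2: _ => // i y1 y2 _ <-. Qed.

Lemma fps_coef0M f g : (f * g) 0%N = f 0%N * g 0%N.
Proof. by rewrite fps_coefM big_ord1 subnn. Qed.

Lemma fps_coefX_gt f k n : f 0%N = 0 -> (n < k)%N -> (f ^+ k) n = 0.
Proof.
move=> f0; elim: k n => // k IHk n lt_nk.
rewrite exprS fps_coefM big1 // => -[[|i] /= lt_in] _; first by rewrite f0 mul0r.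
rewrite IHk ?mulr0 //; case: n lt_nk lt_in => // n lt_nk lt_in.
by rewrite subSS (leq_ltn_trans (leq_subr _ _)).
Qed.

Definition fpsC (a : R) : {fps R} := Fps (fun n => if n is 0%N then a else 0).
Definition fpsX : {fps R} := Fps (fun n => (n == 1%N)%:R).

Lemma fps_coefCM a f n : (fpsC a * f) n = a * f n.
Proof.
rewrite fps_coefM big_ord_recl subn0 big1 ?addr0 // => i _.
by rewrite mul0r.
Qed.

(* (f - f 0) / X *)
Definition fps_shift f : {fps R} := Fps (fun n => f n.+1).

Lemma fps_shiftE f : fpsX * fps_shift f = f - fpsC (f 0%N).
Proof.
apply/fpsP => -[|n]; first by rewrite fps_coef0M mul0r fps_coefB subrr.
rewrite fps_coefM !big_ord_recl !mul0r add0r mul1r /= subSS subn0.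
by rewrite big1 ?addr0 ?subr0 // => i _; rewrite mul0r.
Qed.

(* The substitution f(g), meaningful when g 0 = 0: then (g ^+ i) n = 0 for    *)
(* i > n, so that the sum of the f i * (g ^+ i) n over all i is finite.       *)
Definition fps_comp f g : {fps R} :=
  Fps (fun n => \sum_(i < n.+1) f i * (g ^+ i) n).

Lemma fps_coef_comp f g n :
  fps_comp f g n = \sum_(i < n.+1) f i * (g ^+ i) n.
Proof. by []. Qed.

Lemma fps_comp_coef0 f g : fps_comp f g 0%N = f 0%N.
Proof. by rewrite fps_coef_comp big_ord1 expr0 fps_coef1 mulr1. Qed.

Lemma fps_comp_coef1 f g : fps_comp f g 1%N = f 1%N * g 1%N.
Proof.
rewrite fps_coef_comp !big_ord_recl big_ord0 expr0 expr1 fps_coef1.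
by rewrite mulr0 add0r addr0.
Qed.

End Ring.

Section UnitRing.
Variable R : comUnitRingType.
Implicit Types f g : {fps R}.

Definition fps_unit : {pred {fps R}} := [pred f : {fps R} | f 0%N \is a GRing.unit].

(* For a unit a = f 0, f^-1 = a^-1 (1 + u + u^2 + ...) with u = 1 - a^-1 f.   *)
Definition fps_inv f : {fps R} :=
  if f \in fps_unit then
    Fps (fun n =>
      \sum_(k < n.+1) (f 0%N)^-1 * ((1 - fpsC (f 0%N)^-1 * f) ^+ k) n)
  else f.

Fact fps_mulV : {in fps_unit, left_inverse 1 fps_inv *%R}.
Proof.
move=> f fU; rewrite /fps_inv fU; set a := (f 0%N)^-1; set u := 1 - _.
have u0 : u 0%N = 0.
  by rewrite fps_coefB fps_coefCM mulVr // fps_coef1 subrr.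
have fE : fpsC a * f = 1 - u by rewrite /u opprB addrC subrK.
apply/fpsP => n; transitivity ((fpsC a * (\sum_(k < n.+1) u ^+ k) * f) n).
  rewrite [LHS]fps_coefM [RHS]fps_coefM; apply: eq_bigr => i _; congr (_ * _).
  rewrite fps_coefCM fps_coef_sum mulr_sumr [LHS]/fps_coef.
  rewrite (big_ord_widen _ (fun k => a * (u ^+ k) i) (ltn_ord i)).
  rewrite big_mkcond; apply: eq_bigr => k _; case: ifPn => //.
  by rewrite -leqNgt => lt_ik; rewrite fps_coefX_gt ?mulr0.
rewrite mulrAC fE -opprB mulNr -subrX1 opprB fps_coefB fps_coefX_gt //.
by rewrite subr0.
Qed.
Fact fps_unitPl f g : g * f = 1 -> fps_unit f.
Proof.
move=> /(congr1 (fun h : {fps R} => h 0%N)); rewrite fps_coef0M => gf.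
by apply/unitrPr; exists (g 0%N); rewrite mulrC.
Qed.
Fact fps_inv_out : {in [predC fps_unit], fps_inv =1 id}.
Proof. by move=> f; rewrite inE /= /fps_inv => /negPf ->. Qed.

HB.instance Definition _ := GRing.ComNzRing_hasMulInverse.Build {fps R}
  fps_mulV fps_unitPl fps_inv_out.

Lemma fps_unitE f : (f \is a GRing.unit) = (f 0%N \is a GRing.unit).
Proof. by []. Qed.

(* The quotient f / g of two series of the form f = X f', g = X g' with g' a  *)
(* unit; here g itself is not a unit of R[[X]].                               *)
Definition fps_quo f g : {fps R} := fps_shift f / fps_shift g.

Lemma fps_quoP f g : f 0%N = 0 -> g 0%N = 0 -> g 1%N \is a GRing.unit ->
  g * fps_quo f g = f.
Proof.
move=> f0 g0 gU.
have shE (h : {fps R}) : h 0%N = 0 -> h = fpsX R * fps_shift h.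
  move=> h0; rewrite fps_shiftE h0.
  by apply/fpsP => -[|n]; rewrite fps_coefB subr0.
rewrite [X in X * _](shE g g0) [RHS](shE f f0) /fps_quo -mulrA.
by rewrite (mulrC (fps_shift g)) divrK // fps_unitE.
Qed.

(* e^g, for g 0 = 0 *)
Definition fps_exp (g : {fps R}) : {fps R} :=
  fps_comp (Fps (fun i => (i`!%:R)^-1)) g.

End UnitRing.

(* Bivariate series.  R[[x,y]] is represented as {fps {fps R}} = R[[y]][[x]]; *)
(* for f in this ring, f l m is the coefficient of x^l y^m.                   *)

Section Bivariate.
Variable R : comUnitRingType.

Definition varx : {fps {fps R}} := fpsX {fps R}.
Definition vary : {fps {fps R}} := fpsC (fpsX R).

(* e^g for g without constant term (g 0 0 = 0): then (g ^+ i) l m = 0 as soon *)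
(* as i > l + m.                                                              *)
Definition fps2_exp (g : {fps {fps R}}) : {fps {fps R}} :=
  Fps (fun l => Fps (fun m =>
    \sum_(i < (l + m).+1) (i`!%:R)^-1 * (g ^+ i) l m)).

(* Convergence of the formal series \sum_j F j to S: every coefficient of the *)
(* partial sums is eventually equal to that of S.                             *)
Definition fps2_is_sum (F : nat -> {fps {fps R}}) (S : {fps {fps R}}) : Prop :=
  forall l m, exists N, forall M, (N <= M)%N ->
    (\sum_(j < M) F j) l m = S l m.

End Bivariate.
Arguments varx {R}.
Arguments vary {R}.

(* Li_k(z) = \sum_(m >= 1) z^m / m^k, over a ring R containing the rationals. *)
Definition polylog (R : comUnitRingType) (k : int) : {fps R} :=
  Fps (fun m => if m is 0%N then 0 else m%:R ^ (- k)).

(* 1 - e^(-t) in Q[x][[t]] *)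
Definition one_sub_expN : {fps {poly rat}} := 1 - fps_exp (- fpsX {poly rat}).

(* e^(-xt) Li_k(1 - e^(-t)) / (1 - e^(-t)) in Q[x][[t]] *)
Definition polyBernoulli_gf (k : int) : {fps {poly rat}} :=
  fps_exp (- (fpsC 'X * fpsX {poly rat})) *
  fps_quo (fps_comp (polylog {poly rat} k) one_sub_expN) one_sub_expN.

Definition polyBernoulli (n : nat) (k : int) : {poly rat} :=
  n`!%:R * polyBernoulli_gf k n.

Lemma polyBernoulli_gfP k :
  one_sub_expN * polyBernoulli_gf k =
  fps_exp (- (fpsC 'X * fpsX {poly rat})) *
  fps_comp (polylog {poly rat} k) one_sub_expN.
Proof.
have u0 : one_sub_expN 0%N = 0.
  by rewrite fps_coefB fps_comp_coef0 /= fact0 invr1 subrr.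
have u1 : one_sub_expN 1%N = 1.
  rewrite fps_coefB fps_comp_coef1 fps_coefN fps_coef1 sub0r mulrN opprK.
  by rewrite [LHS]/= invr1 mulr1.
by rewrite /polyBernoulli_gf mulrCA fps_quoP ?fps_comp_coef0 ?u1 ?unitr1.
Qed.

(* Unsigned Stirling numbers of the first kind *)
Fixpoint stirling1 (n m : nat) : nat :=
  match n, m with
  | 0, 0 => 1
  | 0, _.+1 => 0
  | _.+1, 0 => 0
  | n'.+1, m'.+1 => stirling1 n' m' + n' * stirling1 n' m'.+1
  end%N.

(* \mathscr{B}_m^{(-l)}(n) *)
Definition scrB (m l n : nat) : rat :=
  \sum_(j < n.+1)
    (stirling1 n j)%:R * (polyBernoulli m (- l%:Z - j%:Z)).[n%:R].

(* Q_j(X), for X a variable of a power series ring A *)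
Definition Qfrac (A : comUnitRingType) (j : nat) (X : A) : A :=
  X ^+ j / \prod_(1 <= i < j.+2) (1 - i%:R * X).

(* Main.v *)
(** Since [Li_{-k}(z) / z] is the sum of the [(p+1)^k z^p] and the Stirling
    numbers expand rising factorials, the exponential generating function of
    [scrB m l n] is the sum over [p] of
    [(p+n)!/p! * e^{(p+1)x} e^{-ny} (1-e^{-y})^p], a negative binomial series
    in [e^x (1 - e^{-y})] that sums to the closed form.  As
    [e^x + e^y - e^{x+y} = 1 - (e^x-1)(e^y-1)], expanding the closed form again,
    now in powers of [(e^x-1)(e^y-1)], gives the second identity: both
    [l!/j! [X^l] e^X (e^X-1)^j] and [[X^l] Q_j(X)] satisfy the recurrence of the
    Stirling numbers of the second kind [S(l+1, j+1)]. *)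
Require Import Defs.
From HB Require Import structures.
From mathcomp Require Import all_boot all_order all_algebra.
From mathcomp Require Import ring.

Set Implicit Arguments.
Unset Strict Implicit.
Unset Printing Implicit Defensive.

Import GRing.Theory.
Local Open Scope ring_scope.

(** * Coefficients, truncated substitution and derivation of power series *)

Section FpsRing.
Variable R : comNzRingType.
Implicit Types (f g h : {fps R}) (a b : R).

Lemma fps_coefMn f k n : (f *+ k) n = f n *+ k.
Proof. by elim: k => [|k IHk] //; rewrite !mulrS fps_coefD IHk. Qed.

Lemma fps_coefXM f n : (fpsX R * f) n.+1 = f n.
Proof.
rewrite fps_coefM !big_ord_recl /= mul0r add0r mul1r subSS subn0.
by rewrite big1 ?addr0 // => i _; rewrite mul0r.
Qed.

Lemma fpsXI : injective ( *%R (fpsX R)).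
Proof. by move=> f g fg; apply/fpsP => n; rewrite -[LHS]fps_coefXM fg fps_coefXM. Qed.

Lemma fpsXnE k n : (fpsX R ^+ k) n = (n == k)%:R.
Proof.
elim: k n => [|k IHk] [|n]; rewrite ?expr0 // exprS.
  by rewrite fps_coef0M mul0r.
by rewrite fps_coefXM IHk eqSS.
Qed.

Fact fpsC_additive : zmod_morphism (@fpsC R).
Proof. by move=> a b; apply/fpsP => -[|n] //=; rewrite subr0. Qed.
Fact fpsC_multiplicative : monoid_morphism (@fpsC R).
Proof.
split; first by apply/fpsP => -[|n].
by move=> a b; apply/fpsP => n; rewrite fps_coefCM; case: n => //= n; rewrite mulr0.
Qed.
HB.instance Definition _ :=
  GRing.isZmodMorphism.Build R {fps R} (@fpsC R) fpsC_additive.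
HB.instance Definition _ :=
  GRing.isMonoidMorphism.Build R {fps R} (@fpsC R) fpsC_multiplicative.

Lemma fps_coef_nat k n : (k%:R : {fps R}) n = k%:R *+ (n == 0)%N.
Proof. by rewrite fps_coefMn fps_coef1 -mulrnA mulnC mulrnA. Qed.

Lemma fps_coefM_natsum f g (c : nat -> nat) M n :
  (f * \sum_(p < M) (c p)%:R * g ^+ p) n =
  \sum_(p < M) (c p)%:R * (f * g ^+ p) n.
Proof.
rewrite mulr_sumr fps_coef_sum; apply: eq_bigr => p _.
by rewrite mulrCA (mulr_natl (f * g ^+ p)) fps_coefMn [RHS]mulr_natl.
Qed.

(** Powers [g ^+ p] with [p > n] do not reach degree [n], so any bound [M > n] will do, and a
    substitution can be computed as a finite sum in the ring. *)
Lemma fps_comp_trunc f g M n : g 0%N = 0 -> (n < M)%N ->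
  fps_comp f g n = (\sum_(p < M) fpsC (f p) * g ^+ p) n.
Proof.
move=> g0 ltnM; rewrite fps_coef_comp fps_coef_sum.
under [RHS]eq_bigr => p _ do rewrite fps_coefCM.
rewrite (big_ord_widen _ (fun k => f k * (g ^+ k) n) ltnM).
rewrite big_mkcond; apply: eq_bigr => k _; case: ifPn => //.
by rewrite -leqNgt => ltnk; rewrite fps_coefX_gt ?mulr0.
Qed.

Lemma fps_coefM_trunc f g h n : (forall i, (i <= n)%N -> g i = h i) ->
  (f * g) n = (f * h) n.
Proof.
by move=> gh; rewrite !fps_coefM; apply: eq_bigr => i _; rewrite gh ?leq_subr.
Qed.

Lemma fps_comp_shift f g : g 0%N = 0 ->
  g * fps_comp (fps_shift f) g = fps_comp f g - fpsC (f 0%N).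
Proof.
(* With the bound [n.+2], cancelling the term [p = 0] leaves exactly the [n.+1] terms of [h]. *)
move=> g0; apply/fpsP => n; rewrite fps_coefB (fps_comp_trunc _ g0 (leqnSn n.+1)).
pose h : {fps R} := \sum_(p < n.+1) fpsC (fps_shift f p) * g ^+ p.
rewrite (@fps_coefM_trunc _ _ h); last first.
  by move=> i lein; apply: fps_comp_trunc.
rewrite -[in RHS]fps_coefB big_ord_recl expr0 mulr1 addrAC subrr add0r.
rewrite mulr_sumr; congr (fps_coef _ n); apply: eq_bigr => p _ /=.
by rewrite mulrCA -exprS.
Qed.

Definition fps_deriv f : {fps R} := Fps (fun n => f n.+1 *+ n.+1).

Lemma fps_coef_deriv f n : fps_deriv f n = f n.+1 *+ n.+1.
Proof. by []. Qed.

Lemma fps_derivM f g :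
  fps_deriv (f * g) = fps_deriv f * g + f * fps_deriv g.
Proof.
apply/fpsP => n; rewrite fps_coefD /= -sumrMnl.
transitivity (\sum_(i < n.+2) (f i *+ i * g (n.+1 - i)%N)
  + \sum_(i < n.+2) (f i * g (n.+1 - i)%N *+ (n.+1 - i))).
  rewrite -big_split; apply: eq_bigr => i _ /=.
  by rewrite mulrnAl -mulrnDr subnKC // -ltnS.
congr (_ + _).
  by rewrite big_ord_recl mulr0n mul0r add0r; apply: eq_bigr.
rewrite big_ord_recr /= subnn mulr0n addr0; apply: eq_bigr => i _.
by rewrite mulrnAr subSn // -ltnS.
Qed.

Lemma fps_derivX f k : fps_deriv (f ^+ k.+1) = fps_deriv f * f ^+ k *+ k.+1.
Proof.
elim: k => [|k IHk]; first by rewrite expr0 mulr1.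
by rewrite exprS fps_derivM IHk [f * _]mulrnAr [f * _]mulrCA -exprS -mulrS.
Qed.

End FpsRing.

Section FpsMap.
Variables (R S : comNzRingType) (phi : {rmorphism R -> S}).

Definition fps_map (f : {fps R}) : {fps S} := Fps (fun n => phi (f n)).

Fact fps_map_additive : zmod_morphism fps_map.
Proof. by move=> f g; apply/fpsP => n /=; rewrite rmorphB. Qed.
Fact fps_map_multiplicative : monoid_morphism fps_map.
Proof.
split; first by apply/fpsP => n /=; rewrite rmorph_nat.
move=> f g; apply/fpsP => n /=; rewrite rmorph_sum.
by apply: eq_bigr => i _; rewrite rmorphM.
Qed.
HB.instance Definition _ :=
  GRing.isZmodMorphism.Build {fps R} {fps S} fps_map fps_map_additive.
HB.instance Definition _ :=
  GRing.isMonoidMorphism.Build {fps R} {fps S} fps_map fps_map_multiplicative.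

End FpsMap.

(** * Exponential series and their images under ring morphisms *)

Section FpsExp.
Variable R : comUnitRingType.
Implicit Types a b : R.

Definition fps_expc a : {fps R} := Fps (fun i => a ^+ i / i`!%:R).

Lemma fps_exp_linear a : fps_exp (fpsC a * fpsX R) = fps_expc a.
Proof.
apply/fpsP => n; rewrite fps_coef_comp big_ord_recr /= big1 ?add0r => [|i _].
  by rewrite exprMn -(rmorphXn (@fpsC R)) fps_coefCM fpsXnE eqxx mulr1 mulrC.
rewrite exprMn -(rmorphXn (@fpsC R)) fps_coefCM fpsXnE gtn_eqF // ?mulr0 //.
Qed.

(** Multiplying by [fpsX] turns the shifts into [fps_comp_shift]. As a result $\mathrm{Li}_k(z)/z$
    at $z = 1 - e^{-t}$ is again a substitution, with explicit coefficients. *)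
Lemma fps_quo_comp (f g : {fps R}) : f 0%N = 0 -> g 0%N = 0 ->
  g 1%N \is a GRing.unit -> fps_quo (fps_comp f g) g = fps_comp (fps_shift f) g.
Proof.
move=> f0 g0 g1; rewrite /fps_quo.
have -> : fps_shift (fps_comp f g) = fps_comp (fps_shift f) g * fps_shift g.
  apply: (@fpsXI R); rewrite mulrCA !fps_shiftE fps_comp_coef0 g0 f0.
  by rewrite rmorph0 !subr0 mulrC fps_comp_shift // f0 rmorph0 subr0.
by rewrite mulrK.
Qed.

Hypothesis factU : forall i, i`!%:R \is a @GRing.unit R.

Lemma fps_expcD a b : fps_expc (a + b) = fps_expc a * fps_expc b.
Proof.
apply/fpsP => n; rewrite fps_coefM /= exprDn mulr_suml.
rewrite (reindex_inj rev_ord_inj) /=; apply: eq_bigr => i _.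
have lein : (i <= n)%N by rewrite -ltnS.
rewrite subSS subKn // bin_sub //.
rewrite [RHS]mulrACA -[_ *+ _]mulr_natr -[LHS]mulrA; congr (_ * _).
apply: (mulIr (factU n)); rewrite divrK // -(bin_fact lein) !natrM.
by rewrite mulrCA mulrACA !mulVr ?mulr1.
Qed.

Lemma fps_expc0 : fps_expc 0 = 1.
Proof.
by apply/fpsP => -[|n]; rewrite fps_coef1 /= ?expr0 ?mul1r ?invr1 // expr0n mul0r.
Qed.

Lemma fps_expcMn a k : fps_expc (a *+ k) = fps_expc a ^+ k.
Proof.
by elim: k => [|k IHk]; rewrite ?fps_expc0 // mulrS exprS fps_expcD IHk.
Qed.

Lemma fps_deriv_expc1 : fps_deriv (fps_expc 1) = fps_expc 1.
Proof.
apply/fpsP => n /=; rewrite !expr1n !mul1r -[LHS]mulr_natr.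
apply: (mulIr (factU n)); rewrite mulVr // -mulrA -natrM -factS mulVr //.
Qed.

End FpsExp.

Section MapExp.
Variables (R S : comUnitRingType) (phi : {rmorphism R -> S}).
Hypothesis factU : forall i, i`!%:R \is a @GRing.unit R.

Lemma fps_map_expc a : fps_map phi (fps_expc a) = fps_expc (phi a).
Proof. by apply/fpsP => n /=; rewrite rmorph_div // rmorphXn rmorph_nat. Qed.

Lemma fps_map_expc_sum a (c : nat -> nat) M :
  fps_map phi (fps_expc a * \sum_(p < M) (c p)%:R * (1 - fps_expc (-1)) ^+ p) =
  fps_expc (phi a) * \sum_(p < M) (c p)%:R * (1 - fps_expc (-1)) ^+ p.
Proof.
rewrite rmorphM rmorph_sum /= fps_map_expc; congr (_ * _); apply: eq_bigr => p _.
by rewrite rmorphM rmorph_nat rmorphXn rmorphB rmorph1 /= fps_map_expc rmorphN1.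
Qed.

End MapExp.

Lemma unit_factr (i : nat) : i`!%:R \is a @GRing.unit rat.
Proof. by rewrite unitfE Num.Theory.pnatr_eq0 -lt0n fact_gt0. Qed.

Lemma unit_fact_poly (i : nat) : i`!%:R \is a @GRing.unit {poly rat}.
Proof. by rewrite -(rmorph_nat (@polyC rat)) rmorph_unit ?unit_factr. Qed.

(** * Stirling numbers of the first kind and poly-Bernoulli values at nonpositive index *)

Lemma stirling1_gt (n m : nat) : (n < m)%N -> stirling1 n m = 0%N.
Proof.
elim: n m => [|n IHn] [|m] //= ltnm.
by rewrite !IHn ?muln0 // (ltn_trans (ltnSn n)).
Qed.

(** The two terms of the recurrence for [stirling1] contribute the summands [a] and [n] of the new
    factor [a + n]. *)
Lemma stirling1_rising (n a : nat) :
  (\sum_(j < n.+1) stirling1 n j * a ^ j = \prod_(i < n) (a + i))%N.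
Proof.
elim: n => [|n IHn]; first by rewrite big_ord1 big_ord0.
rewrite [RHS]big_ord_recr /= -IHn [LHS]big_ord_recl mul0n add0n.
under eq_bigr => j _ do rewrite /= mulnDl.
rewrite big_split /= mulnDr; congr (_ + _)%N.
  by rewrite big_distrl; apply: eq_bigr => j _ /=; rewrite -mulnA -expnSr.
rewrite big_ord_recr /= stirling1_gt // muln0 mul0n addn0.
rewrite big_distrl [RHS]big_ord_recl /=.
(* The term [j = 0] vanishes: either the factor [n] or [stirling1 n 0] is zero. *)
rewrite [X in _ = (X + _)%N](_ : _ = 0)%N ?add0n; last by case: (n).
by apply: eq_bigr => j _; rewrite [RHS]mulnC mulnA.
Qed.

(** The rising factorial $(p+1)\cdots(p+n)$ equals $(p+n)!/p!$; the binomial form matches the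
    coefficients of the negative binomial series. *)
Lemma stirling1_bin (n p : nat) :
  (\sum_(j < n.+1) stirling1 n j * p.+1 ^ j = n`! * 'C(p + n, n))%N.
Proof.
rewrite stirling1_rising; apply/eqP; rewrite -(eqn_pmul2r (fact_gt0 p)).
apply/eqP; transitivity (p + n)`!.
  elim: n => [|n IHn]; first by rewrite big_ord0 mul1n addn0.
  by rewrite big_ord_recr /= mulnAC IHn addnS factS mulnC addSn.
by rewrite -(bin_fact (leq_addl p n)) addnK mulnCA mulnA.
Qed.

(** By [fps_quo_comp], $\mathrm{Li}_{-K}(z)/z$ contributes the coefficients $(p+1)^K$. The bound [M]
    stays free so that these sums can later be read as partial sums of a bivariate series. *)
Lemma polyBernoulli_gf_neg (K m M : nat) : (m < M)%N ->
  polyBernoulli_gf (- K%:Z) m =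
  (fps_expc (- 'X) *
   \sum_(p < M) (p.+1 ^ K)%:R * (1 - fps_expc (-1)) ^+ p) m.
Proof.
move=> ltmM; have oE : one_sub_expN = 1 - fps_expc (-1).
  by rewrite /one_sub_expN -fps_exp_linear rmorphN1 mulN1r.
have o0 : one_sub_expN 0%N = 0.
  by rewrite oE fps_coefB /= expr0 invr1 mulr1 subrr.
rewrite /polyBernoulli_gf -mulNr -rmorphN fps_exp_linear fps_quo_comp //; last first.
  by rewrite oE fps_coefB /= expr1 invr1 mulr1 sub0r opprK unitr1.
apply: fps_coefM_trunc => i leim.
rewrite (fps_comp_trunc _ o0 (leq_ltn_trans leim ltmM)) oE.
congr (fps_coef _ i); apply: eq_bigr => p _ /=.
by rewrite opprK -exprnP -natrX rmorph_nat.
Qed.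

(** Evaluation at $x = n$ is a ring morphism, applied coefficientwise; it sends $e^{-xt}$ to
    $(e^{-t})^n$. *)
Lemma polyBernoulli_neg (K n m M : nat) : (m < M)%N ->
  (polyBernoulli m (- K%:Z)).[n%:R] = m`!%:R *
  (fps_expc (-1) ^+ n *
   \sum_(p < M) (p.+1 ^ K)%:R * (1 - fps_expc (-1)) ^+ p : {fps rat}) m.
Proof.
move=> ltmM; rewrite /polyBernoulli hornerM (polyBernoulli_gf_neg _ ltmM).
rewrite -[(_%:R).[_]]/(horner_eval n%:R _) rmorph_nat; congr (_ * _).
have := fps_map_expc_sum (horner_eval (n%:R : rat)) unit_fact_poly
  (- 'X) (fun p => p.+1 ^ K)%N M.
rewrite rmorphN /= /horner_eval hornerX -mulNrn fps_expcMn; last exact: unit_factr.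
by move=> /(congr1 (fun f : {fps rat} => f m)).
Qed.

(** For fixed [p], summing over [j] collects the powers $(p+1)^{l+j}$ into $(p+1)^l$ times the value
    of [stirling1_bin]. *)
Lemma scrB_trunc (m l n M : nat) : (m < M)%N ->
  scrB m l n = m`!%:R * \sum_(p < M) (p.+1 ^ l * (n`! * 'C(p + n, n)))%:R *
  (fps_expc (-1) ^+ n * (1 - fps_expc (-1)) ^+ p : {fps rat}) m.
Proof.
move=> ltmM; rewrite /scrB.
under eq_bigr => j _.
  rewrite -opprD -PoszD (polyBernoulli_neg _ _ ltmM) mulrCA.
  rewrite (fps_coefM_natsum _ _ (fun p => p.+1 ^ (l + j))%N) mulr_sumr.
  over.
rewrite -mulr_sumr exchange_big; congr (_ * _); apply: eq_bigr => p _.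
move: (fps_coef _ m) => b; rewrite -stirling1_bin big_distrr /= natr_sum mulr_suml.
apply: eq_bigr => j _.
by rewrite mulrA -natrM mulnCA -expnD.
Qed.

(** * Convergent bivariate sums and the negative binomial series *)

Section Summation.
Variable R : comUnitRingType.
Implicit Types (f g u S : {fps {fps R}}) (F : nat -> {fps {fps R}}).

Lemma fps2_is_sum_unique F S S' : fps2_is_sum F S -> fps2_is_sum F S' -> S = S'.
Proof.
move=> FS FS'; apply/fpsP => l; apply/fpsP => m.
have [[N FN] [N' FN']] := (FS l m, FS' l m).
by rewrite -(FN (maxn N N')) ?leq_maxl // FN' ?leq_maxr.
Qed.

(** Peel off one factor [u]: the induction hypothesis kills every term except the one that carries
    the constant term of [u], which is zero. *)
Lemma fps2_coefM_gt u g k : u 0%N 0%N = 0 ->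
  forall l m, (l + m < k)%N -> (g * u ^+ k) l m = 0.
Proof.
move=> u0; elim: k => // k IHk l m ltk.
rewrite exprSr mulrA fps_coefM fps_coef_sum big1 // => i _.
rewrite [LHS]fps_coefM big1 // => j _.
have [lt_ijk|le_kij] := ltnP (i + j) k; first by rewrite IHk ?mul0r.
have [leil lejm] : (i <= l /\ j <= m)%N by split; rewrite -ltnS.
have lelm : (l + m <= i + j)%N by apply: leq_trans le_kij.
have [] : ((i : nat) = l /\ (j : nat) = m)%N.
  have := leq_add leil lejm => leij.
  have eqij : (i + j = l + m)%N by apply/eqP; rewrite eqn_leq leij.
  split; apply/eqP; rewrite eqn_leq ?leil ?lejm /=.
    by rewrite -(leq_add2r m) -eqij leq_add2l.
  by rewrite -(leq_add2l l) -eqij leq_add2r.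
by move=> -> ->; rewrite !subnn u0 mulr0.
Qed.

(** An exact remainder, multiple of [u ^+ M], keeps the proof purely algebraic; [fps2_coefM_gt]
    removes it from any given coefficient once [M] is large. *)
Lemma bin_series_trunc (A : comUnitRingType) (u : A) n M :
  1 - u \is a GRing.unit -> exists r,
  \sum_(j < M) 'C(j + n, n)%:R * u ^+ j = (1 - u)^-1 ^+ n.+1 + r * u ^+ M.
Proof.
move=> uU; elim: n => [|n [r IHn]].
  exists (- (1 - u)^-1); apply: (mulrI uU).
  under eq_bigr => j _ do rewrite bin0 mul1r.
  transitivity (1 - u ^+ M); first by rewrite -opprB mulNr -subrX1 opprB.
  by rewrite expr1 mulrDr mulrA mulrN divrr // mulN1r.
(* By Pascal's rule, $(1-u)\sum_{j<M}\binom{j+n+1}{n+1}u^j = \sum_{j<M}\binom{j+n}{n}u^j -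
   \binom{M+n}{n+1}u^M$, whence the new remainder. *)
exists ((1 - u)^-1 * (r - 'C(M + n, n.+1)%:R)); apply: (mulrI uU).
rewrite (exprS _ n.+1) mulrDr !mulrA divrr // !mul1r [(r - _) * _]mulrBl addrA -{}IHn.
elim: M => [|M IHM].
  by rewrite !big_ord0 mulr0 add0n bin_small // mul0r subr0.
rewrite !big_ord_recr /= mulrDr {}IHM addnS addSn binS natrD.
by rewrite exprS; ring.
Qed.

Lemma fps2_is_sum_bin u c n : u 0%N 0%N = 0 ->
  fps2_is_sum (fun j => c * ('C(j + n, n)%:R * u ^+ j)) (c / (1 - u) ^+ n.+1).
Proof.
move=> u0 l m; exists (l + m).+1 => M ltM.
have uU : 1 - u \is a GRing.unit.
  by rewrite fps_unitE fps_unitE !fps_coefB u0 subr0 unitr1.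
rewrite -mulr_sumr; have [r ->] := bin_series_trunc n M uU.
by rewrite mulrDr mulrA exprVn !fps_coefD (fps2_coefM_gt _ u0) // addr0.
Qed.

End Summation.

(** * The exponential generating function of [scrB] *)

Section Egf.
Implicit Types f g : {fps rat}.

Local Notation fps_inx := (fps_map (@fpsC rat)).
Local Notation fps_iny := (@fpsC {fps rat}).

Lemma fps_inxyE f g l m : (fps_inx f * fps_iny g) l m = f l * g m.
Proof. by rewrite mulrC fps_coefCM mulrC fps_coefCM. Qed.

Lemma varxE : varx = fps_inx (fpsX rat).
Proof.
by apply/fpsP => k; apply/fpsP => -[|m] /=; rewrite fps_coef_nat.
Qed.

Lemma fps2_exp_x : fps2_exp varx = fps_inx (fps_expc 1).
Proof.
apply/fpsP => l; apply/fpsP => m /=.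
rewrite expr1n mul1r; under eq_bigr => i _ do rewrite fpsXnE fps_coef_nat.
rewrite (bigD1 (inord l)) //= inordK ?ltnS ?leq_addr // big1 ?addr0 => [|i neq].
  by rewrite eqxx; case: m => [|m]; rewrite ?mulr1 ?mulr0.
rewrite (_ : (l == i) = false) ?mul0rn ?mulr0 //.
apply: contraNF neq => li.
by rewrite -val_eqE /= inordK ?ltnS ?leq_addr // eq_sym.
Qed.

Lemma fps2_exp_y : fps2_exp vary = fps_iny (fps_expc 1).
Proof.
apply/fpsP => l; apply/fpsP => m /=.
under eq_bigr => i _ do rewrite -rmorphXn /=.
case: l => [|l] /=; last by rewrite big1 // => i _; rewrite mulr0.
rewrite big_ord_recr /= big1 ?add0r => [|i _].
  by rewrite fpsXnE eqxx expr1n mulr1 mul1r.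
by rewrite fpsXnE gtn_eqF // mulr0.
Qed.

(** The power $(x+y)^i$ is homogeneous of degree [i], so only [i = l + m] contributes to $x^l y^m$,
    with $\binom{l+m}{l}/(l+m)! = 1/(l!\,m!)$. *)
Lemma fps2_exp_xy :
  fps2_exp (varx + vary) = fps_inx (fps_expc 1) * fps_iny (fps_expc 1).
Proof.
have xyE i l m : ((varx + vary) ^+ i : {fps {fps rat}}) l m =
    'C(l + m, l)%:R *+ (i == l + m)%N.
  rewrite exprDn !fps_coef_sum.
  rewrite varxE.
  under eq_bigr => k _ do
    rewrite !fps_coefMn -!rmorphXn fps_inxyE !fpsXnE.
  have [->|neq] := eqVneq i (l + m)%N.
    rewrite (bigD1 (inord m)) //= inordK ?ltnS ?leq_addl // addnK !eqxx.
    rewrite mulr1 -bin_sub ?leq_addl // addnK big1 ?addr0 // => k neq.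
    rewrite (_ : (m == k) = false) ?mulr0 ?mul0rn //.
    apply: contraNF neq => mk.
    by rewrite -val_eqE /= inordK ?ltnS ?leq_addl // eq_sym.
  rewrite big1 // => k _; case: eqP => [lk|]; last by rewrite mul0r mul0rn.
  case: eqP => [mk|]; last by rewrite mulr0 mul0rn.
  by rewrite lk mk subnK ?eqxx // -ltnS in neq.
apply/fpsP => l; apply/fpsP => m; rewrite fps_inxyE /= !expr1n !mul1r.
under eq_bigr => i _ do rewrite xyE.
rewrite big_ord_recr /= eqxx big1 ?add0r => [|i _]; last first.
  by rewrite ltn_eqF // mulr0.
apply: (mulrI (unit_factr (l + m))); rewrite mulrA divrr ?unit_factr // mul1r.
rewrite -(bin_fact (leq_addr m l)) addKn !natrM -mulrA mulrACA.
by rewrite !divrr ?unit_factr ?mulr1.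
Qed.

(** This form of the denominator serves both halves of the theorem: it expands to $e^x+e^y-e^{x+y}$,
    and its inverse powers expand in $(e^x-1)(e^y-1)$. *)
Lemma scrB_egf (n : nat) :
  Fps (fun l => Fps (fun m => scrB m l n / l`!%:R / m`!%:R)) =
  n`!%:R * (fps_inx (fps_expc 1) * fps_iny (fps_expc 1))
  / (1 - (fps_inx (fps_expc 1) - 1) * (fps_iny (fps_expc 1) - 1)) ^+ n.+1.
Proof.
set X := fps_inx _; set Y := fps_iny _; set w := fps_iny (fps_expc (-1)).
have wY : w * Y = 1.
  by rewrite -rmorphM -fps_expcD ?addNr ?fps_expc0 ?rmorph1 //; apply: unit_factr.
set u := X * (1 - w).
have u00 : u 0%N 0%N = 0.
  rewrite /u /X /w -(rmorph1 fps_iny) -rmorphB fps_inxyE fps_coefB /=.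
  by rewrite !expr0 invr1 mulr1 subrr mulr0.
transitivity (n`!%:R * X * w ^+ n / (1 - u) ^+ n.+1).
  apply: (@fps2_is_sum_unique _ (fun p =>
    n`!%:R * X * w ^+ n * ('C(p + n, n)%:R * u ^+ p))); last first.
    exact: fps2_is_sum_bin.
  (* The bound [m.+1] works whatever [l] is, because [1 - w] has no constant term in $y$. *)
  move=> l m; exists m.+1 => M ltmM.
  rewrite [RHS]/= (scrB_trunc _ _ ltmM) !fps_coef_sum.
  rewrite [m`!%:R * _]mulrC [RHS]mulrAC mulrK ?unit_factr // mulr_suml.
  apply: eq_bigr => p _.
  transitivity ((fps_inx (fps_expc p.+1%:R) *
    fps_iny (fps_expc (-1) ^+ n * (1 - fps_expc (-1)) ^+ p)
      *+ (n`! * 'C(p + n, n))) l m).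
    congr (fps_coef (fps_coef _ l) m).
    rewrite fps_expcMn; last exact: unit_factr.
    rewrite rmorphM !rmorphXn rmorphB rmorph1 -/X -/w /u.
    by rewrite -[RHS]mulr_natl natrM exprMn exprS; ring.
  rewrite !fps_coefMn fps_inxyE /= -natrX -mulr_natl !natrM; ring.
(* As $wY = 1$, factoring $Y$ out of the denominator leaves $Y / Y^{n+1} = w^n$ on the right-hand
   side. *)
have XY1 : 1 - (X - 1) * (Y - 1) = Y * (1 - u).
  have -> : Y * (1 - u) = Y - X * Y + X * (w * Y) by rewrite /u; ring.
  by rewrite wY; ring.
have YU : Y \is a GRing.unit by apply/unitrPr; exists w; rewrite mulrC.
rewrite XY1 exprMn invrM ?unitrX //; last first.
  by rewrite fps_unitE fps_unitE !fps_coefB u00 subr0 unitr1.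
have -> : w = Y^-1 by rewrite -[LHS](mulrK YU) wY mul1r.
have <- : Y / Y ^+ n.+1 = Y^-1 ^+ n.
  by rewrite exprS invrM ?unitrX // mulrCA divrr // mulr1 exprVn.
by rewrite -!mulrA [X in _ = _ * (_ * (_ * X))]mulrC.
Qed.

(** * The series $Q_j$ and powers of $e^X - 1$ *)

Lemma unit_oneBX k : 1 - k%:R * fpsX rat \is a GRing.unit.
Proof. by rewrite fps_unitE fps_coefB fps_coef0M mulr0 subr0 unitr1. Qed.

(** The denominators differ by one factor, so $(1-(j+2)X)\,Q_{j+1} = X Q_j$; then compare
    coefficients. *)
Lemma Qfrac_coefS j l :
  Qfrac j.+1 (fpsX rat) l.+1 =
  Qfrac j (fpsX rat) l + j.+2%:R * Qfrac j.+1 (fpsX rat) l.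
Proof.
have QE : Qfrac j.+1 (fpsX rat) =
    fpsX rat * (Qfrac j (fpsX rat) + Qfrac j.+1 (fpsX rat) *+ j.+2).
  have PU k : \prod_(1 <= i < k.+1) (1 - i%:R * fpsX rat) \is a GRing.unit.
    elim: k => [|k IHk]; first by rewrite big_nil unitr1.
    by rewrite big_nat_recr //= unitrM IHk unit_oneBX.
  have QS : Qfrac j.+1 (fpsX rat) * (1 - j.+2%:R * fpsX rat) =
      fpsX rat * Qfrac j (fpsX rat).
    rewrite /Qfrac exprS big_nat_recr //= invrM ?unit_oneBX //.
    by rewrite -!mulrA [_^-1 * (_^-1 * _)]mulrCA mulVr ?mulr1 ?unit_oneBX.
  by rewrite mulrDr -QS -mulr_natl; ring.
by rewrite {1}QE fps_coefXM fps_coefD fps_coefMn mulr_natl.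
Qed.

Lemma Qfrac0_coef l : Qfrac 0 (fpsX rat) l = 1.
Proof.
pose g : {fps rat} := Fps (fun=> 1).
have gE : g * (1 - fpsX rat) = 1.
  apply/fpsP => -[|k]; rewrite mulrBr mulr1 mulrC fps_coefB.
    by rewrite fps_coef0M mul0r subr0.
  by rewrite fps_coefXM subrr.
have U : 1 - fpsX rat \is a GRing.unit.
  by rewrite fps_unitE fps_coefB subr0 unitr1.
by rewrite /Qfrac expr0 big_nat1 [1%:R * _]mul1r -[X in X / _]gE mulrK.
Qed.

(** Induction on [l]: differentiation shifts coefficients, and up to factorials the differential
    equation [fS] is the recurrence [Qfrac_coefS]. *)
Lemma exp_expm1_coef j l :
  (fps_expc 1 * (fps_expc 1 - 1) ^+ j : {fps rat}) l * l`!%:R =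
  j`!%:R * Qfrac j (fpsX rat) l.
Proof.
pose E : {fps rat} := fps_expc 1.
have dE : fps_deriv E = E by apply: fps_deriv_expc1; apply: unit_factr.
have dE1 : fps_deriv (E - 1) = E.
  rewrite -[RHS]dE; apply/fpsP => k /=.
  by rewrite subr0.
(* The factor [E] produced by differentiating $(E-1)^{k+1}$ is split as $(E-1)+1$. *)
have fS k : fps_deriv (E * (E - 1) ^+ k.+1) =
    E * (E - 1) ^+ k.+1 *+ k.+2 + E * (E - 1) ^+ k *+ k.+1.
  by rewrite fps_derivM fps_derivX dE dE1 exprS !mulrS; ring.
have Q0 k : Qfrac k.+1 (fpsX rat) 0%N = 0.
  by rewrite /Qfrac exprS -mulrA fps_coef0M mul0r.
elim: l j => [|l IHl] [|j].
- by rewrite Qfrac0_coef expr0 mulr1 /= expr0 invr1 !mulr1.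
- by rewrite Q0 mulr0 exprS mulrCA fps_coef0M fps_coefB /= expr0 invr1 mulr1 subrr !mul0r.
- rewrite Qfrac0_coef expr0 !mulr1 /= expr1n mul1r mulVr ?unit_factr //.
have /(congr1 (fun f : {fps rat} => f l)) := fS j.
rewrite fps_coef_deriv fps_coefD !fps_coefMn -[LHS]mulr_natr => fSl.
rewrite Qfrac_coefS -/E (factS l) natrM mulrA fSl mulrDl.
rewrite -[X in X * _ + _]mulr_natl -[X in _ + X * _]mulr_natl -!mulrA !IHl.
rewrite (factS j) natrM; move: (fps_coef _ l) (fps_coef _ l) (j`!%:R) => q r c.
by ring.
Qed.

(** Morphisms preserve inverses of units, whence the hypothesis; this reduces $Q_j(x)$ and $Q_j(y)$
    to series in one variable. *)
Lemma rmorph_Qfrac (A B : comUnitRingType) (phi : {rmorphism A -> B}) j (X : A) :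
  (forall i, 1 - i%:R * X \is a GRing.unit) -> phi (Qfrac j X) = Qfrac j (phi X).
Proof.
move=> U; rewrite /Qfrac rmorph_div; last first.
  by apply: rpred_prod => i _; apply: U.
rewrite rmorphXn rmorph_prod; congr (_ / _); apply: eq_bigr => i _.
by rewrite rmorphB rmorph1 rmorphM rmorph_nat.
Qed.

Lemma Qfrac_xyE j l m : (Qfrac j varx * Qfrac j vary) l m =
  Qfrac j (fpsX rat) l * Qfrac j (fpsX rat) m.
Proof.
by rewrite varxE -!rmorph_Qfrac ?fps_inxyE //; apply: unit_oneBX.
Qed.

End Egf.

Theorem theorem2p1 (n : nat) :
  (Fps (fun l => Fps (fun m => scrB m l n / l`!%:R / m`!%:R))
     = n`!%:R * fps2_exp (varx + vary)
       / (fps2_exp varx + fps2_exp vary - fps2_exp (varx + vary)) ^+ n.+1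
     :> {fps {fps rat}})
  /\
  fps2_is_sum
    (fun j => j`!%:R * (j + n)`!%:R * Qfrac j varx * Qfrac j vary)
    (Fps (fun l => Fps (fun m => scrB m l n)) : {fps {fps rat}}).
Proof.
split.
  rewrite scrB_egf fps2_exp_xy fps2_exp_x fps2_exp_y; congr (_ / _ ^+ _).
  by rewrite mulrBl mulrBr !mulr1 mul1r; ring.
have := scrB_egf n; set X := fps_map _ _; set Y := fpsC _.
have u0 : ((X - 1) * (Y - 1)) 0%N 0%N = 0.
  by rewrite fps_coef0M fps_coef0M !fps_coefB /= invr1 subrr mul0r.
move=> egf l m.
have [N sumN] := fps2_is_sum_bin (n`!%:R * (X * Y)) n u0 l m.
exists N => M leNM; have := sumN M leNM; rewrite -egf /= => {}sumN.
transitivity (scrB m l n / l`!%:R / m`!%:R * m`!%:R * l`!%:R); last first.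
  by rewrite !divrK ?unit_factr.
rewrite -sumN !fps_coef_sum !mulr_suml; apply: eq_bigr => j _.
(* Each term separates into a series in $x$ times a series in $y$, so that [exp_expm1_coef] applies
   to both. *)
have -> : n`!%:R * (X * Y) * ('C(j + n, n)%:R * ((X - 1) * (Y - 1)) ^+ j) =
  fps_map (@fpsC rat) (fps_expc 1 * (fps_expc 1 - 1) ^+ j) *
  fpsC (fps_expc 1 * (fps_expc 1 - 1) ^+ j) *+ (n`! * 'C(j + n, n)).
  rewrite !rmorphM !rmorphXn !rmorphB !rmorph1 -/X -/Y exprMn.
  by rewrite -[RHS]mulr_natl natrM; ring.
rewrite !fps_coefMn fps_inxyE -natrM -mulrA mulr_natl !fps_coefMn Qfrac_xyE.
rewrite !mulrnAl mulrAC -mulrA mulrACA !exp_expm1_coef.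
(* One of the two factors $j!$ joins $n!\binom{j+n}{n}$ to form $(j+n)!$. *)
rewrite -(bin_fact (leq_addl j n)) addnK -[LHS]mulr_natl -[RHS]mulr_natl !natrM.
by move: (fps_coef _ l) (fps_coef _ m) => q r; ring.
Qed.
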